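(* (1) Let $X$ be a (non-empty) complete separable metric space and let $\mathcal{B}_X$ be the $\sigma$-algebra of Borel subsets of $X$. Then $(X,\mathcal{B}_X)$ is a type $\mathcal{B}$ space. Consequently any standard Borel space is a separable type $\mathcal{B}$ space. (2) Each separable type $\mathcal{B}$ space is a standard Borel space.
   Context: $\mathbb{N}=\{0,1,2,\ldots\}$. A measurable space is a pair $(X,\mathcal{E})$ with $X$ a non-empty set and $\mathcal{E}$ a $\sigma$-algebra of subsets of $X$. It is countably generated if $\mathcal{E}=\sigma(\mathcal{S})$ for some countable $\mathcal{S}\subset\mathcal{E}$, and separable if $\{x\}\in\mathcal{E}$ for each $x\in X$. It is standard Borel if there exists a metric on $X$ making $X$ a complete separable metric space whose Borel $\sigma$-algebra is $\mathcal{E}$. A mapping $f:(X,\mathcal{E})\to(Y,\mathcal{F})$ between measurable spaces is measurable if $f^{-1}(\mathcal{F})\subset\mathcal{E}$ and exactly measurable if $f^{-1}(\mathcal{F})=\mathcal{E}$, where $f^{-1}(\mathcal{F})=\{f^{-1}(F):F\in\mathcal{F}\}$. Let $\mathsf{M}=\{0,1\}^{\mathbb{N}}$ with the product topology ($\{0,1\}$ discrete) and let $\mathcal{B}$ be the $\sigma$-algebra of Borel subsets of $\mathsf{M}$. A countably generated measurable space $(X,\mathcal{E})$ is a type $\mathcal{B}$ space if there exists an exactly measurable mapping $f:(X,\mathcal{E})\to(\mathsf{M},\mathcal{B})$ with $f(X)\in\mathcal{B}$. *)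

(* Defs.v *)
From HB Require Import structures.
From mathcomp Require Import all_boot all_order all_algebra.
From mathcomp Require Import all_classical all_reals all_analysis.

Set Implicit Arguments.
Unset Strict Implicit.
Unset Printing Implicit Defensive.

Local Open Scope classical_set_scope.

(* Non-empty metric spaces, non-emptiness being rendered by a distinguished
   point as in pseudoPMetricType and measurableType. *)
#[short(type="pmetricType")]
HB.structure Definition PointedMetric (R : numDomainType) :=
  {M of PseudoPointedMetric R M & PseudoMetric_isMetric R M}.

Definition metrized (R : numFieldType) (T : pointedType) (m : isMetric R T) :
    pmetricType R :=
  HB.pack T m.

(* The axiom of the library's Complete structure, as a predicate. *)
Definition complete_space (T : puniformType) : Prop :=
  forall F : set_system T, ProperFilter F -> cauchy F -> cvg F.

Definition separable_space (T : topologicalType) : Prop :=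
  exists2 D : set T, countable D & dense D.

Notation borel_space T := (g_sigma_algebraType (@open T)).

Definition countably_generated d (X : measurableType d) : Prop :=
  exists S : set (set X),
    [/\ countable S, S `<=` measurable & measurable = <<s S >>].

Definition separable_measurable d (X : measurableType d) : Prop :=
  forall x : X, measurable [set x].

Definition exactly_measurable d d' (X : measurableType d)
    (Y : measurableType d') (f : X -> Y) : Prop :=
  preimage_set_system setT f measurable = measurable.

Definition type_B d (X : measurableType d) : Prop :=
  countably_generated X /\
  exists2 f : X -> borel_space cantor_space,
    exactly_measurable f & measurable (range f).

Definition standard_borel (R : realType) d (X : measurableType d) : Prop :=
  exists m : isMetric R X,
    [/\ complete_space (metrized m), separable_space (metrized m) &
        (measurable : set (set X)) = <<s @open (metrized m) >>].

(* Main.v *)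
Require Import Defs.
From mathcomp Require Import all_boot all_order all_algebra.
From mathcomp Require Import all_classical all_reals all_analysis.

(** Both halves encode points by sequences of discrete symbols.

From Polish to type B.  Let [U] be a countable base of the complete separable
metric space [X] and let [x] be coded by the 0-1 sequence of the truth values
of [x \in U n].  The base generates the Borel sets, so this code is exactly
measurable ([membership_code_exact]).  Its range is Borel because the codes of
points are recognised by countably many conditions on coordinates
([code_of_point]): the selected [U n] are non-empty, arbitrarily small, any two
of them contain the closure of a third, and the selection is closed under
enlargement.  Such a selection is a Cauchy filter base, and completeness gives
the point whose code it is ([code_of_pointP]).

From type B to Polish.  An exactly measurable [f] on a separable measurable
space is injective, so the points of [X] are coded by the elements of a Borel
set [A] of the Cantor space.  The set [A] need not be closed, but membership
in a Borel set has a derivation, and the steps of that derivation can be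
recorded: to every [x] one attaches a sequence of integers [r x] such that [r]
is measurable, its graph is closed, and [A] is the clopen condition
[r x 0 <> 0].  The sets that admit such an [r] contain the coordinate sets and
form a sigma-algebra ([resolvable0], [resolvableC], [resolvable_bigcup]); for a
union one records the first index of a set containing [x], which turns an
existential condition into a closed one.  Hence [x |-> (f x, r (f x))] sends
[X] bijectively onto a closed set of sequences of symbols, and the metric given
by the first place where two sequences differ makes [X] Polish with the
required Borel sets ([closed_coding_standard_borel]). *)

Set Implicit Arguments.
Unset Strict Implicit.
Unset Printing Implicit Defensive.

Import Order.TTheory GRing.Theory Num.Theory.

Local Open Scope classical_set_scope.

(** * Measurability of countable first-order conditions *)

Section measurable_predicates.
Context d (T : measurableType d).

Lemma measurable_exists (I : countType) (P : I -> T -> Prop) :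
  (forall i, measurable [set x | P i x]) ->
  measurable [set x | exists i, P i x].
Proof.
move=> mP; rewrite (_ : [set x | _] = \bigcup_i [set x | P i x]).
  exact: countable_bigcupT_measurable.
by apply/seteqP; split=> x [i]; [exists i | exists i].
Qed.

Lemma measurable_not (P : T -> Prop) :
  measurable [set x | P x] -> measurable [set x | ~ P x].
Proof. exact: measurableC. Qed.

Lemma measurable_forall (I : countType) (P : I -> T -> Prop) :
  (forall i, measurable [set x | P i x]) ->
  measurable [set x | forall i, P i x].
Proof.
move=> mP; rewrite (_ : [set x | _] = [set x | ~ exists i, ~ P i x]).
  by apply/measurable_not/measurable_exists => i; apply/measurable_not.
by apply/seteqP; split=> x /= => [h [i]|/forallNP h i]; [apply|exact: contrapT].
Qed.

Lemma measurable_conj (P Q : T -> Prop) :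
  measurable [set x | P x] -> measurable [set x | Q x] ->
  measurable [set x | P x /\ Q x].
Proof. exact: measurableI. Qed.

Lemma measurable_implies (P Q : T -> Prop) :
  measurable [set x | P x] -> measurable [set x | Q x] ->
  measurable [set x | P x -> Q x].
Proof.
move=> mP mQ; rewrite (_ : [set x | _] = ~` [set x | P x] `|` [set x | Q x]).
  by apply: measurableU => //; exact: measurableC.
apply/seteqP; split=> x /= => [h|[]//].
by have [/h|] := pselect (P x); [right|left].
Qed.

Lemma measurable_prop (P : Prop) : measurable [set _ : T | P].
Proof.
by have [p|np] := pselect P;
  [rewrite (_ : mkset _ = setT)|rewrite (_ : mkset _ = set0)] => //;
  apply/seteqP; split.
Qed.

End measurable_predicates.

(** * Countable bases and Borel sets *)

Definition base_family (T : topologicalType) I (U : I -> set T) :=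
  (forall i, open (U i)) /\
  (forall x A, nbhs x A -> exists i, U i x /\ U i `<=` A).

(** An open set is the union of the countably many base sets it contains, so
the base already generates every Borel set. *)
Lemma borel_base (T : ptopologicalType) (I : countType) (U : I -> set T) :
  base_family U -> <<s @open T >> = <<s range U >>.
Proof.
move=> [oU bU]; apply/seteqP; split; apply: smallest_sub => //; last first.
  by move=> _ [i _ <-]; exact: sub_sigma_algebra.
move=> A oA.
pose S := g_sigma_algebraType (range U).
rewrite (_ : A = [set x | exists i, U i `<=` A /\ U i x]).
  apply: (@measurable_exists _ S) => i; apply: (@measurable_conj _ S).
    exact: (@measurable_prop _ S).
  by apply: sub_sigma_algebra; exists i.
apply/seteqP; split=> [x Ax|x [i [+ Ux]]]; last exact.
by have [i [Ux UA]] := bU x A (open_nbhs_nbhs (conj oA Ax)); exists i.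
Qed.

Definition coordinate_sets T (K : Type) (s : T -> nat -> K) : set (set T) :=
  range (fun p : nat * K => [set x | s x p.1 = p.2]).

(** The finite intersections of coordinate sets, indexed by lists of prescribed
values, form a countable base when [s] determines the neighbourhoods.  This
serves both the Cantor space and the metric constructed from a coding. *)
Lemma borel_coordinates (T : ptopologicalType) (K : countType)
    (s : T -> nat -> K) :
    (forall n k, open [set x | s x n = k]) ->
    (forall x A, nbhs x A ->
      exists l : seq nat, [set y | {in l, s y =1 s x}] `<=` A) ->
  <<s @open T >> = <<s coordinate_sets s >>.
Proof.
move=> os ns; apply/seteqP; split; last first.
  apply: smallest_sub => // _ [p _ <-]; apply: sub_sigma_algebra; exact: os.
pose cyl (w : seq (nat * K)) := [set x | all (fun p => s x p.1 == p.2) w].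
have cylE p w : cyl (p :: w) = [set x | s x p.1 = p.2] `&` cyl w.
  by apply/seteqP; split=> x; rewrite /cyl /=; [case/andP=> /eqP|case=> -> ->];
    rewrite ?eqxx.
have cyl0 : cyl [::] = setT by apply/seteqP; split.
rewrite (@borel_base _ _ cyl); last first.
  split=> [w|x A /ns[l lA]].
    elim: w => [|p w IH]; first by rewrite cyl0; exact: openT.
    by rewrite cylE; apply: openI => //; exact: os.
  exists [seq (n, s x n) | n <- l]; split; first by apply/allP => _ /mapP[n _ ->].
  move=> y /allP yl; apply: lA => n nl; apply/eqP/(yl (n, s x n)).
  by apply/mapP; exists n.
apply: smallest_sub => // _ [w _ <-].
pose S := g_sigma_algebraType (coordinate_sets s).
elim: w => [|p w IH]; first by rewrite cyl0; exact: (@measurableT _ S).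
rewrite cylE; apply: (@measurableI _ S) => //.
by apply: sub_sigma_algebra; exists p.
Qed.

(** Naming the projections keeps the type [cantor_space] visible to the
topology, which would otherwise be lost by unfolding to a function type. *)
Definition cantor_coord (x : cantor_space) (n : nat) : bool := x n.

Lemma cantor_coord_open n b : open [set x | cantor_coord x n = b].
Proof.
have pn : continuous (cantor_coord^~ n).
  exact: (@proj_continuous nat (fun=> bool) n).
by apply: (iffLR (continuousP _) pn [set b]); exact: discrete_open.
Qed.

Lemma nbhs_cantor (x : cantor_space) (A : set cantor_space) : nbhs x A ->
  exists l : seq nat, [set y | {in l, cantor_coord y =1 cantor_coord x}] `<=` A.
Proof.
pose F := filter_from [set: seq nat]
  (fun l => [set y | {in l, cantor_coord y =1 cantor_coord x}]).
have FF : Filter F.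
  apply: filter_from_filter; first by exists [::].
  move=> l l' _ _; exists (l ++ l') => // y /= yx.
  by split=> i il; apply: yx; rewrite mem_cat il ?orbT.
have Fx : F --> x.
  (* the topology is the supremum of those induced by single coordinates *)
  apply/cvg_sup => n B [C [[V oV VC] Cx CB]].
  exists [:: n] => // y /(_ n (mem_head _ _)) yx; apply: CB; rewrite -VC /=.
  by move: Cx yx; rewrite -VC /= /cantor_coord => Vx ->.
by move=> /Fx [l _ lA]; exists l.
Qed.

Lemma borel_cantor : <<s @open cantor_space >> = <<s coordinate_sets cantor_coord >>.
Proof. exact: borel_coordinates cantor_coord_open nbhs_cantor. Qed.

(** * Complete separable metric spaces are of type B *)

(** Pulling back commutes with generating a sigma-algebra. *)
Lemma preimage_borel_cantor T (f : T -> cantor_space) :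
  preimage_set_system setT f <<s @open cantor_space >> =
  <<s coordinate_sets (fun x => cantor_coord (f x)) >>.
Proof.
rewrite borel_cantor.
transitivity <<s preimage_set_system setT f (coordinate_sets cantor_coord) >>.
  by rewrite g_sigma_preimageE.
congr <<s _ >>; apply/seteqP; split=> [_ [_ [p _ <-] <-]|_ [p _ <-]].
  by exists p => //; rewrite setTI.
by exists [set x | cantor_coord x p.1 = p.2]; [exists p|rewrite setTI].
Qed.

Section membership_code.
Context (T : ptopologicalType) (U : nat -> set T).

Definition membership_code (x : T) : cantor_space := fun n => `[< U n x >].

Lemma membership_codeE x n : cantor_coord (membership_code x) n <-> U n x.
Proof. by split=> /asboolP. Qed.

Lemma membership_code_exact : base_family U ->
  exactly_measurable
    (membership_code : borel_space T -> borel_space cantor_space).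
Proof.
move=> bU; rewrite /exactly_measurable.
transitivity <<s coordinate_sets (fun x => cantor_coord (membership_code x)) >>.
  exact: preimage_borel_cantor.
transitivity <<s range U >>; last by rewrite -borel_base.
apply/seteqP; split; apply: smallest_sub => //.
- have mU n : <<s range U >> (U n) by apply: sub_sigma_algebra; exists n.
  move=> _ [[n [] _] <-] /=.
    rewrite (_ : mkset _ = U n) //.
    by apply/seteqP; split=> x /membership_codeE.
  rewrite (_ : mkset _ = setT `\` U n); first exact: sigma_algebraCD.
  apply/seteqP; split=> x /=.
    by move=> /negbT/negP nx; split=> // /membership_codeE.
  by move=> [_ nx]; apply/negP => /membership_codeE.
- move=> _ [n _ <-]; apply: sub_sigma_algebra; exists (n, true) => //.
  by apply/seteqP; split=> x /membership_codeE.
Qed.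

Lemma borel_countably_generated : base_family U ->
  countably_generated (borel_space T).
Proof.
move=> bU; exists (range U); split.
- exact: card_image_le.
- by move=> _ [n _ <-]; apply: sub_sigma_algebra; exact: bU.1.
- exact: borel_base.
Qed.

End membership_code.

Lemma measurable_cantor_coord n :
  measurable [set x : borel_space cantor_space | cantor_coord x n].
Proof. by apply: sub_sigma_algebra; exact: (cantor_coord_open n true). Qed.

Section range_of_code.
Context (R : realType) (X : pmetricType R) (U : nat -> set X).
Hypothesis bU : base_family U.
Hypothesis cX : complete_space X.

Definition finer_than k : set (set X) :=
  [set A | forall x y, A x -> A y -> ball x k.+1%:R^-1%R y].

(** The codes of points, described without mentioning the point.  Taking
[n = n'] in the third clause puts the closure of a selected set inside each
selected [U n], which is what forces the limit point into the open set itself.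
All quantifiers range over integers, so these codes form a Borel set. *)
Definition code_of_point (m : cantor_space) : Prop :=
  [/\ forall n, cantor_coord m n -> U n !=set0,
      forall k, exists n, finer_than k (U n) /\ cantor_coord m n,
      forall n n', cantor_coord m n -> cantor_coord m n' ->
        exists p, closure (U p) `<=` U n `&` U n' /\ cantor_coord m p &
      forall n n', U n' `<=` U n -> cantor_coord m n' -> cantor_coord m n].

Lemma membership_codeP x : code_of_point (membership_code U x).
Proof.
have [oU nU] := bU; split.
- by move=> n /membership_codeE Ux; exists x.
- move=> k; have e0 : (0 < (k.+1%:R^-1 / 2) :> R)%R by [].
  have [n [Ux Ub]] := nU x _ (nbhsx_ballx x _ e0).
  exists n; split; last exact/membership_codeE.
  move=> y z /Ub xy /Ub xz; rewrite (splitr k.+1%:R^-1%R).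
  by apply: ball_triangle xz; exact: ball_sym.
- move=> n n' /membership_codeE xn /membership_codeE xn'.
  have : nbhs x (U n `&` U n').
    by apply: open_nbhs_nbhs; split=> //; apply: openI.
  move=> /(@uniform_regular X x)[V xV clV].
  have [p [Up UV]] := nU _ _ xV; exists p; split; last exact/membership_codeE.
  by apply: subset_trans clV; exact: closureS.
- by move=> n n' sub /membership_codeE/sub ?; exact/membership_codeE.
Qed.

(** The selected sets form a Cauchy filter base.  Its limit lies in every
selected set by the closure clause; conversely an open [U n] around the limit
contains a selected set, hence is selected by the last clause. *)
Lemma code_of_pointP m : code_of_point m -> exists x, membership_code U x = m.
Proof.
move=> [ne small dir up].
pose F := filter_from [set n | cantor_coord m n] U.
have FF : ProperFilter F.
  apply: filter_from_proper => //; apply: filter_from_filter.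
    by have [n [_ mn]] := small 0%N; exists n.
  move=> n n' mn mn'; have [p [sub mp]] := dir n n' mn mn'.
  by exists p => //; apply: subset_trans sub; exact: subset_closure.
have /cX/cvg_ex[x Fx] : cauchy F.
  apply/cauchy_exP => e e0.
  have [k] := ltr_add_invr e0; rewrite add0r => ke.
  have [n [nk mn]] := small k; have [z Uz] := ne n mn.
  exists z; exists n => // y Uy; apply: le_ball (ltW ke) _ _; exact: nk.
exists x; apply/funext => n; apply/idP/idP.
  move=> /membership_codeE Ux.
  have [n' mn' sub] : F (U n).
    by apply: Fx; apply: open_nbhs_nbhs; split=> //; exact: bU.1.
  exact: up sub mn'.
move=> mn; apply/membership_codeE.
have [p [sub mp]] := dir n n mn mn.
suff /sub[] : closure (U p) x by [].
move=> A /Fx FA; have FU : F (U p) by exists p.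
by have [y] := filter_ex (filterI FU FA); exists y.
Qed.

Lemma measurable_range_membership_code :
  measurable (range (membership_code U) : set (borel_space cantor_space)).
Proof.
rewrite (_ : range _ = [set m | code_of_point m]); last first.
  apply/seteqP; split=> [_ [x _ <-]|m /code_of_pointP[x <-]].
    exact: membership_codeP.
  by exists x.
pose C : measurableType _ := borel_space cantor_space.
have mC n := measurable_cantor_coord n.
rewrite (_ : mkset _ =
    [set m : C | forall n, cantor_coord m n -> U n !=set0] `&`
    [set m : C | forall k, exists n, finer_than k (U n) /\ cantor_coord m n] `&`
    [set m : C | forall n n', cantor_coord m n -> cantor_coord m n' ->
        exists p, closure (U p) `<=` U n `&` U n' /\ cantor_coord m p] `&`
    [set m : C | forall n n', U n' `<=` U n -> cantor_coord m n' ->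
      cantor_coord m n]); last first.
  by apply/seteqP; split=> m /= [] => [|[[]]].
have mP := @measurable_prop _ C.
do 3?[apply: (@measurableI _ C)].
- apply: (@measurable_forall _ C) => n; exact: (@measurable_implies _ C).
- apply: (@measurable_forall _ C) => k; apply: (@measurable_exists _ C) => n.
  exact: (@measurable_conj _ C).
- apply: (@measurable_forall _ C) => n; apply: (@measurable_forall _ C) => n'.
  apply: (@measurable_implies _ C) => //; apply: (@measurable_implies _ C) => //.
  apply: (@measurable_exists _ C) => p.
  exact: (@measurable_conj _ C).
- apply: (@measurable_forall _ C) => n; apply: (@measurable_forall _ C) => n'.
  by apply: (@measurable_implies _ C) => //; apply: (@measurable_implies _ C).
Qed.

End range_of_code.

(** Interiors of balls of radius [1 / k.+1] around a dense sequence; the index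
[n] decodes to a pair (centre, radius), with the empty set as filler. *)
Lemma separable_base (R : realType) (X : pmetricType R) :
  separable_space X -> exists U : nat -> set X, base_family U.
Proof.
move=> [D cD dD].
have /pcard_surjP[g gD] : (D #<= [set: nat])%card by [].
pose B (p : nat * nat) : set X := (ball (g p.1) p.2.+1%:R^-1%R)°.
exists (fun n => if unpickle n is Some p then B p else set0).
split=> [n|x A].
  by case: unpickle => [p|]; [exact: open_interior|exact: open0].
rewrite -nbhs_ballE => -[e e0 eA].
have [k] := ltr_add_invr (divr_gt0 e0 (ltr0n R 2)); rewrite add0r => ke.
have k0 : (0 < k.+1%:R^-1 :> R)%R by [].
have h0 : (0 < k.+1%:R^-1 / 2 :> R)%R by [].
have [|z [Bz Dz]] := dD _ _ (@open_interior _ (ball x (k.+1%:R^-1 / 2)%R)).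
  by exists x; exact: nbhsx_ballx.
have [i _ giz] : [set g n | n in setT] z by exact: gD.
(* z is within half the radius of x, so the ball around z is a neighbourhood
   of x; it has radius less than e / 2 and thus stays inside the e-ball *)
exists (pickle (i, k)); rewrite pickleK /B /= giz; split.
  have xz : nbhs x (ball x (k.+1%:R^-1 / 2)) by exact: nbhsx_ballx.
  apply: filterS xz => y xy; rewrite (splitr k.+1%:R^-1%R).
  by apply: ball_triangle xy; apply: ball_sym; exact: interior_subset.
move=> y /interior_subset zy; apply: eA; rewrite /= (splitr e).
apply: (@ball_triangle _ _ z).
  apply: le_ball (interior_subset Bz); apply: le_trans (ltW ke).
  by rewrite ler_pdivrMr// ler_pMr// ler1n.
exact: le_ball (ltW ke) _ zy.
Qed.

(** * A closed injective coding yields a Polish metric *)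

(** The range of [s] is closed for the product of the discrete topologies: a
sequence matched by points on each finite set of coordinates is itself in the
range.  Finite sets of coordinates are lists rather than initial segments, so
that reindexing coordinates is just a [map]. *)
Definition closed_range T (K : eqType) (s : T -> nat -> K) : Prop :=
  forall u : nat -> K, (forall l : seq nat, exists x, {in l, s x =1 u}) ->
    exists x, s x = u.

Section sequence_metric.
Local Open Scope ring_scope.
Context (R : realType) (K : eqType).
Implicit Types u v w : nat -> K.

(** The usual ultrametric of the Baire space. *)
Definition seq_dist u v : R :=
  if pselect (exists n, u n != v n) is left e then (ex_minn e).+1%:R^-1 else 0.

Lemma seq_distxx u : seq_dist u u = 0.
Proof. by rewrite /seq_dist; case: pselect => // e; case: ex_minnP => n /eqP. Qed.

Lemma seq_dist_ge u v n : u n != v n -> n.+1%:R^-1 <= seq_dist u v.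
Proof.
move=> uv; rewrite /seq_dist; case: pselect => [e|[]]; last by exists n.
by case: ex_minnP => m _ /(_ n uv) mn; rewrite lef_pV2 ?posrE // ler_nat.
Qed.

Lemma seq_dist_le u v n : (forall i, (i < n)%N -> u i = v i) ->
  seq_dist u v <= n.+1%:R^-1.
Proof.
move=> uv; rewrite /seq_dist; case: pselect => // e.
case: ex_minnP => m um _; rewrite lef_pV2 ?posrE // ler_nat ltnS leqNgt.
by apply/negP => /uv /eqP; apply/negP.
Qed.

Lemma seq_dist_ltP u v n i : seq_dist u v < n.+1%:R^-1 -> (i <= n)%N ->
  u i = v i.
Proof.
move=> uv ni; apply/eqP; apply: contraTT uv => uv; rewrite -leNgt.
by apply: le_trans (seq_dist_ge uv); rewrite lef_pV2 ?posrE // ler_nat.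
Qed.

Lemma seq_dist_eq0 u v : seq_dist u v = 0 -> u = v.
Proof.
move=> uv; apply/funext => i; apply: (@seq_dist_ltP u v i i) => //.
by rewrite uv.
Qed.

Lemma seq_dist_ge0 u v : 0 <= seq_dist u v.
Proof. by rewrite /seq_dist; case: pselect. Qed.

Lemma seq_dist_sym u v : seq_dist u v = seq_dist v u.
Proof.
suff le a b : seq_dist a b <= seq_dist b a by apply/le_anti; rewrite !le.
rewrite {1}/seq_dist; case: pselect => [e|_]; last exact: seq_dist_ge0.
by case: ex_minnP => n ab _; apply: seq_dist_ge; rewrite eq_sym.
Qed.

(** Where [u] and [w] first differ, [v] differs from one of them. *)
Lemma seq_dist_triangle v u w : seq_dist u w <= seq_dist u v + seq_dist v w.
Proof.
rewrite {1}/seq_dist; case: pselect => [e|_]; last first.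
  by rewrite addr_ge0 ?seq_dist_ge0.
case: ex_minnP => n uw _; have [uv|uv] := eqVneq (u n) (v n).
  rewrite -[leLHS]add0r lerD ?seq_dist_ge0 //; apply: seq_dist_ge.
  by rewrite -uv.
by rewrite -[leLHS]addr0 lerD ?seq_dist_ge0 //; exact: seq_dist_ge.
Qed.

End sequence_metric.

Section closed_coding.
Local Open Scope ring_scope.
Context (R : realType) (X : pointedType) (K : countType) (s : X -> nat -> K).
Hypothesis s_inj : injective s.

Let dist x y : R := seq_dist R (s x) (s y).

Let distxx x : dist x x = 0. Proof. exact: seq_distxx. Qed.
Let dist_eq0 x y : dist x y = 0 -> x = y.
Proof. by move=> /seq_dist_eq0/s_inj. Qed.
Let dist_sym x y : dist x y = dist y x. Proof. exact: seq_dist_sym. Qed.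
Let dist_triangle y x z : dist x z <= dist x y + dist y z.
Proof. exact: seq_dist_triangle. Qed.

Definition coded_metric : isMetric R X :=
  isMetric.Build R X distxx dist_eq0 dist_sym dist_triangle.

Let M := metrized coded_metric.

Lemma coded_ballE (x : M) (e : R) : ball x e = [set y : M | seq_dist R (s x) (s y) < e].
Proof. by []. Qed.

Lemma coded_ball_prefix (x : M) (e : R) : 0 < e -> exists n,
  [set y : M | forall i, (i < n)%N -> s y i = s x i] `<=` ball x e.
Proof.
move=> e0; have [n] := ltr_add_invr e0; rewrite add0r => ne.
exists n => y yx; rewrite coded_ballE /=; apply: le_lt_trans ne.
by apply: seq_dist_le => i /yx.
Qed.

(** Along a Cauchy filter each coordinate is eventually constant, which defines
the limit sequence; closedness of the range turns it into a point. *)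
Lemma coded_complete : closed_range s -> complete_space M.
Proof.
move=> cs F FF /cauchyP FC.
have n0 n : 0 < n.+1%:R^-1 :> R by [].
have /choice[z Fz] : forall n, exists x, F (ball x n.+1%:R^-1).
  by move=> n; exact: FC.
pose u n := s (z n) n.
have Fu n : F [set y | s y n = u n].
  by apply: filterS (Fz n) => y; rewrite coded_ballE => /seq_dist_ltP/(_ (leqnn _)).
have Ful (l : seq nat) : F [set y | {in l, s y =1 u}].
  elim: l => [|n l IH]; first by apply: filterS filterT.
  apply: filterS (filterI (Fu n) IH) => y [yn yl] i.
  by rewrite inE => /predU1P[->//|/yl].
have [l|x sx] := cs u; first by have [y] := filter_ex (Ful l); exists y.
apply/cvg_ex; exists x => A; rewrite -nbhs_ballE => -[e /= e0 eA].
have [n nA] := coded_ball_prefix x e0.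
apply: filterS (Ful (iota 0 n)) => y yu; apply/eA/nA => i ni.
by rewrite sx; apply: yu; rewrite mem_iota.
Qed.

(** One point for each finite prefix that occurs. *)
Lemma coded_separable : separable_space M.
Proof.
pose pick_prefix (w : seq K) : M :=
  if pselect (exists x, mkseq (s x) (size w) = w) is left e
  then projT1 (cid e) else point.
exists (range pick_prefix).
  exact: sub_countable (card_image_le _ _) (countableP _).
move=> A [x Ax] oA.
have := open_nbhs_nbhs (conj oA Ax); rewrite -nbhs_ballE => -[e e0 eA].
have [n nA] := coded_ball_prefix x e0.
exists (pick_prefix (mkseq (s x) n)); split; last by exists (mkseq (s x) n).
apply/eA/nA => i ni; rewrite /pick_prefix size_mkseq.
case: pselect => [h|[]]; last by exists x.
case: cid => y /= /(congr1 (nth (s x i) ^~ i)).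
by rewrite !nth_mkseq.
Qed.

Lemma coded_open n k : open [set x : M | s x n = k].
Proof.
rewrite openE => x xn; rewrite /interior -nbhs_ballE.
exists n.+1%:R^-1 => //= y; rewrite coded_ballE /= => /seq_dist_ltP/(_ (leqnn _)) yx.
by rewrite -yx.
Qed.

Lemma coded_borel : <<s @open M >> = <<s coordinate_sets s >>.
Proof.
apply: (@borel_coordinates M K s coded_open) => x A.
rewrite -nbhs_ballE => -[e e0 eA]; have [n nA] := coded_ball_prefix x e0.
exists (iota 0 n) => y yx; apply/eA/nA => i ni.
by apply: yx; rewrite mem_iota.
Qed.

End closed_coding.

Lemma closed_coding_standard_borel (R : realType) d (X : measurableType d)
    (K : countType) (s : X -> nat -> K) :
    injective s -> closed_range s -> measurable = <<s coordinate_sets s >> ->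
  standard_borel R X.
Proof.
move=> si cs ms; exists (coded_metric R si); split.
- exact: coded_complete.
- exact: coded_separable.
- by rewrite coded_borel.
Qed.

(** * Borel sets of the Cantor space are resolvable *)

Local Notation cantor := (borel_space cantor_space).

(** Closedness in the product of the Cantor space and the space of integer
sequences, in the same finite-coordinate form as [closed_range]. *)
Definition closed_graph (r : cantor -> nat -> nat) : Prop :=
  forall (x : cantor) (u : nat -> nat),
    (forall l : seq nat, exists y : cantor,
      {in l, cantor_coord y =1 cantor_coord x} /\ {in l, r y =1 u}) ->
    r x = u.

(** Coordinate 0 decides membership in [A]; the others carry enough evidence to
make the decision a closed relation. *)
Definition resolution (A : set cantor) (r : cantor -> nat -> nat) : Prop :=
  [/\ forall i k, measurable [set x | r x i = k],
      closed_graph r &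
      A = [set x | r x 0%N <> 0%N]].

Definition resolvable : set (set cantor) := [set A | exists r, resolution A r].

Lemma resolvable_coord n b : resolvable [set x | cantor_coord x n = b].
Proof.
exists (fun x _ => nat_of_bool (cantor_coord x n == b)); split.
- move=> i k; rewrite (_ : mkset _ =
    [set x : cantor | exists c, nat_of_bool (c == b) = k /\ cantor_coord x n = c]).
    apply: (@measurable_exists _ cantor) => c.
    apply: (@measurable_conj _ cantor); first exact: measurable_prop.
    apply: sub_sigma_algebra; exact: cantor_coord_open.
  by apply/seteqP; split=> x /= => [xk|[c [<- ->]]//]; exists (cantor_coord x n).
- move=> x u xu; apply/funext => i.
  have [y [yx yu]] := xu [:: n; i].
  by rewrite /= -(yx n) ?inE ?eqxx // -yu ?inE ?eqxx ?orbT.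
- by apply/seteqP; split=> x /=; [move=> ->; rewrite eqxx|case: eqP].
Qed.

Lemma resolvable0 : resolvable set0.
Proof.
exists (fun _ _ => 0%N); split.
- by move=> i k; exact: measurable_prop.
- move=> x u xu; apply/funext => i; have [y [_ yu]] := xu [:: i].
  by rewrite -yu ?mem_head.
- by apply/seteqP; split.
Qed.

(** The old resolution is kept, shifted by one, because the negated decision
alone need not have a closed graph. *)
Lemma resolvableC A : resolvable A -> resolvable (setT `\` A).
Proof.
move=> [r [mr cr ->]].
exists (fun x i => if i is j.+1 then r x j else nat_of_bool (r x 0%N == 0%N)).
split.
- case=> [|i] k; last exact: mr.
  rewrite (_ : mkset _ =
    [set x : cantor | exists c, nat_of_bool (c == 0%N) = k /\ r x 0%N = c]).
    apply: (@measurable_exists _ cantor) => c.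
    by apply: (@measurable_conj _ cantor); first exact: measurable_prop.
  by apply/seteqP; split=> x /= => [xk|[c [<- ->]]//]; exists (r x 0%N).
- move=> x u xu.
  have rx : r x = (fun i => u i.+1).
    apply: cr => l; have [y [yx yu]] := xu (l ++ [seq i.+1 | i <- l]).
    exists y; split=> i il; first by rewrite yx // mem_cat il.
    by rewrite -yu // mem_cat map_f ?orbT.
  apply/funext => -[|i]; last by rewrite rx.
  have [y [_ yu]] := xu [:: 0%N; 1%N].
  by rewrite -(yu 0%N) // rx -(yu 1%N).
- apply/seteqP; split=> x /=; first by case=> _ /contrapT ->.
  by move=> h; split=> // x0; apply: h; case: eqP.
Qed.

Definition first_index (t : nat -> nat) : nat :=
  if pselect (exists k, t k != 0%N) is left e then (ex_minn e).+1 else 0%N.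

Lemma first_index0P t : first_index t = 0%N <-> forall k, t k = 0%N.
Proof.
rewrite /first_index; case: pselect => [e|ne]; split=> //.
  by move=> t0; case: ex_minnP => n; rewrite t0.
by move=> _ k; apply/eqP/negPn/negP => tk; apply: ne; exists k.
Qed.

Lemma first_indexSP t m :
  first_index t = m.+1 <-> t m <> 0%N /\ forall k, (k < m)%N -> t k = 0%N.
Proof.
rewrite /first_index; case: pselect => [e|ne]; split=> //.
- case: ex_minnP => n /eqP tn nle [<-]; split=> // k kn.
  by apply/eqP; apply: contraTT kn => /nle; rewrite -leqNgt.
- move=> [/eqP tm lt0]; congr _.+1; case: ex_minnP => n tn /(_ m tm) nm.
  by apply/eqP; rewrite eqn_leq nm leqNgt; apply: contra tn => /lt0 ->.
- by move=> [/eqP tm]; case: ne; exists m.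
Qed.

(** Although [first_index] is discontinuous at the zero sequence, its graph is
closed: the value 0 asserts countably many equations and a value [m.+1] only
constrains [t] up to [m].  Two coordinates suffice to compare a candidate value
with the actual one. *)
Lemma first_index_closed t v :
  (forall l : seq nat, exists t', first_index t' = v /\ {in l, t' =1 t}) ->
  first_index t = v.
Proof.
move=> tv; have [t' [t'v t't]] := tv [:: v.-1; (first_index t).-1].
have e1 : t' v.-1 = t v.-1 by apply: t't; rewrite mem_head.
have e2 : t' (first_index t).-1 = t (first_index t).-1.
  by apply: t't; rewrite !inE eqxx orbT.
case tw : (first_index t) e2 => [|w] /= e2; case: v => [|v] in tv t'v t't e1 * => //.
- move: tw t'v => /first_index0P t0 /first_indexSP[].
  by rewrite /= in e1; rewrite e1 t0.
- by move: tw t'v => /first_indexSP[+ _] /first_index0P t'0; rewrite -e2 t'0.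
- move: tw t'v => /first_indexSP[tw tlt] /first_indexSP[t'v t'lt].
  rewrite /= in e1; case: (ltngtP w v) => [wv|vw|->//].
    by case: tw; rewrite -e2 t'lt.
  by case: t'v; rewrite e1 tlt.
Qed.

(** The decision for the union is the first index of a set containing [x]; the
evidence is the interleaving of all the resolutions. *)
Lemma resolvable_bigcup (A : (set cantor)^nat) :
  (forall n, resolvable (A n)) -> resolvable (\bigcup_n A n).
Proof.
move=> /choice[r rA].
pose t x k := r k x 0%N.
pose q x i := if unpickle i is Some p then r p.1 x p.2 else 0%N.
have qE x k i : q x (pickle (k, i)) = r k x i by rewrite /q pickleK.
have mr k i c : measurable [set x | r k x i = c] by have [] := rA k.
exists (fun x i => if i is j.+1 then q x j else first_index (t x)); split.
- case=> [|i] c /=; last first.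
    by rewrite /q; case: unpickle => [p|]; [exact: mr|exact: measurable_prop].
  case: c => [|c].
    rewrite (_ : mkset _ = [set x : cantor | forall k, t x k = 0%N]).
      by apply: (@measurable_forall _ cantor) => k; exact: mr.
    by apply/seteqP; split=> x /first_index0P.
  rewrite (_ : mkset _ = [set x : cantor |
      t x c <> 0%N /\ forall k, (k < c)%N -> t x k = 0%N]).
    apply: (@measurable_conj _ cantor).
      by apply: (@measurable_not _ cantor); exact: mr.
    apply: (@measurable_forall _ cantor) => k.
    apply: (@measurable_implies _ cantor); first exact: measurable_prop.
    exact: mr.
  by apply/seteqP; split=> x /first_indexSP.
- move=> x u xu.
  have rx k : r k x = (fun i => u (pickle (k, i)).+1).
    have [_ ck _] := rA k; apply: ck => l.
    have [y [yx yu]] := xu (l ++ [seq (pickle (k, i)).+1 | i <- l]).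
    exists y; split=> i il; first by rewrite yx // mem_cat il.
    rewrite -yu ?qE // mem_cat; apply/orP; right.
    by apply/mapP; exists i.
  apply/funext => -[|i].
    apply: first_index_closed => l.
    have [y [_ yu]] := xu (0%N :: [seq (pickle (k, 0%N)).+1 | k <- l]).
    exists (t y); split; first by rewrite -yu ?mem_head.
    move=> k kl; rewrite /t rx -yu ?qE // inE; apply/orP; right.
    by apply/mapP; exists k.
  (* i may decode to (k, j) without being its canonical code, so the value at i
     is compared with the one at pickle (k, j) *)
  rewrite /q; case E : unpickle => [[k j]|] /=.
    have [y [_ yu]] := xu [:: i.+1; (pickle (k, j)).+1].
    rewrite rx -yu ?inE ?eqxx ?orbT // qE.
    by rewrite -yu ?inE ?eqxx // /q E.
  by have [y [_ yu]] := xu [:: i.+1]; rewrite -yu ?mem_head // /q E.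
- apply/seteqP; split=> x /=.
    move=> [n _]; have [_ _ ->] := rA n => /= xn /first_index0P/(_ n) //.
  move=> x0; apply: contrapT => nA; apply: x0; apply/first_index0P => k.
  apply: contrapT => xk; apply: nA; exists k => //.
  by have [_ _ ->] := rA k.
Qed.

Lemma borel_resolvable (A : set cantor) : measurable A -> resolvable A.
Proof.
suff : <<s @open cantor_space >> `<=` resolvable by apply.
rewrite borel_cantor; apply: smallest_sub.
  split; [exact: resolvable0|exact: resolvableC|exact: resolvable_bigcup].
by move=> _ [[n b] _ <-]; exact: resolvable_coord.
Qed.

(** * The two directions *)

Lemma complete_separable_type_B (R : realType) (X : pmetricType R) :
  complete_space X -> separable_space X -> type_B (borel_space X).
Proof.
move=> cX /separable_base[U bU]; split; first exact: borel_countably_generated bU.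
exists (membership_code U); first exact: membership_code_exact.
exact: measurable_range_membership_code.
Qed.

Lemma metric_borel_set1 (R : realType) (X : pmetricType R) (x : X) :
  <<s @open X >> [set x].
Proof.
have cl : closed [set x].
  apply: accessible_closed_set1; apply: hausdorff_accessible.
  exact: (@metric_hausdorff R X).
rewrite (_ : [set x] = setT `\` ~` [set x]); last by rewrite setTD setCK.
apply: sigma_algebraCD.
by apply: sub_sigma_algebra; exact: closed_openC.
Qed.

Lemma standard_borel_separable_type_B (R : realType) d (X : measurableType d) :
  standard_borel R X -> separable_measurable X /\ type_B X.
Proof.
move=> [m [cm sm mE]]; split.
  by move=> x; rewrite mE; exact: metric_borel_set1.
have [[S [cS Sm SE]] [f ef rf]] := complete_separable_type_B cm sm.
split; first by exists S; split=> //; rewrite mE.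
by exists f => //; rewrite /exactly_measurable mE.
Qed.

(** A singleton is a preimage under [f], and preimages cannot tell apart points
with the same image. *)
Lemma exactly_measurable_inj d d' (X : measurableType d) (Y : measurableType d')
    (f : X -> Y) :
  exactly_measurable f -> separable_measurable X -> injective f.
Proof.
move=> ef sX x y fxy; have := sX x; rewrite -ef => -[B _].
rewrite setTI => fB.
have Bx : (f @^-1` B) x by rewrite fB.
have : (f @^-1` B) y by move: Bx; rewrite /= fxy.
by rewrite fB.
Qed.

(** The coding pairs [f x] with its evidence of belonging to the range of [f].
A limit of codes is [(y, r y)] because the graph of [r] is closed, and
[r y 0 <> 0] because that value is already attained by a code, so [y] is in the
range of [f]. *)
Lemma separable_type_B_standard_borel (R : realType) d (X : measurableType d) :
  separable_measurable X -> type_B X -> standard_borel R X.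
Proof.
move=> sX [_ [f ef /borel_resolvable[r [mr cr rE]]]].
have fi := exactly_measurable_inj ef sX.
have mf (B : set cantor) : measurable B -> measurable (f @^-1` B).
  by move=> mB; rewrite -ef; exists B => //; rewrite setTI.
pose s (x : X) n := (cantor_coord (f x) n, r (f x) n).
apply: (@closed_coding_standard_borel R d X _ s).
- move=> x y sxy; apply: fi; apply/funext => n.
  by have [] := congr1 (@^~ n) sxy.
- move=> u su.
  pose y : cantor := fun n => (u n).1.
  have ry : r y = (fun n => (u n).2).
    apply: cr => l; have [x xu] := su l; exists (f x).
    by split=> i /xu su_i; rewrite /y /cantor_coord -su_i.
  have [x _ fx] : range f y.
    rewrite rE /= ry; have [x xu] := su [:: 0%N].
    rewrite -xu ?mem_head //= -/([set z | r z 0%N <> 0%N] (f x)) -rE.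
    by exists x.
  exists x; apply/funext => n.
  by rewrite /s fx ry /y /cantor_coord -surjective_pairing.
- have -> : measurable = <<s coordinate_sets (fun x => cantor_coord (f x)) >>.
    by rewrite -preimage_borel_cantor -ef.
  apply/seteqP; split; apply: smallest_sub => //.
  + move=> _ [[n b] _ <-].
    pose S := g_sigma_algebraType (coordinate_sets s).
    rewrite (_ : mkset _ = [set x | exists k, s x n = (b, k)]).
      apply: (@measurable_exists _ S) => k.
      by apply: sub_sigma_algebra; exists (n, (b, k)).
    apply/seteqP; split=> x /= => [xn|[k []//]].
    by exists (r (f x) n); rewrite /s xn.
  + move=> _ [[n [b k]] _ <-] /=.
    rewrite -preimage_borel_cantor.
    rewrite -[preimage_set_system _ _ _]/(preimage_set_system setT f measurable).
    rewrite ef.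
    rewrite (_ : mkset _ = f @^-1` [set x | cantor_coord x n = b] `&`
      f @^-1` [set x | r x n = k]).
      apply: measurableI; apply: mf; last exact: mr.
      by apply: sub_sigma_algebra; exact: cantor_coord_open.
    apply/seteqP; split=> x; rewrite /s /=; first by case=> <- <-.
    by case=> <- <-.
Qed.

Theorem theorem6p1 (R : realType) :
  ((forall X : pmetricType R,
      complete_space X -> separable_space X -> type_B (borel_space X)) /\
   (forall (d : measure_display) (X : measurableType d),
      standard_borel R X -> separable_measurable X /\ type_B X)) /\
  (forall (d : measure_display) (X : measurableType d),
      separable_measurable X -> type_B X -> standard_borel R X).
Proof.
split; [split|].
- exact: complete_separable_type_B.
- exact: standard_borel_separable_type_B.
- exact: separable_type_B_standard_borel.
Qed.
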